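(* Let $D$ be a complete division ring of characteristic $0$, let $x_0,h\in D$, and let $f:D\to D$ be a map differentiable in the Gâteaux sense up to any order. If $$f(x_0)=\partial f(x_0)(h)=\dots=\partial^nf(x_0)(h)=0,$$ then for $t\to0$ ($t\in\mathbb R$) the expression $f(x_0+th)$ is infinitesimal of order higher than $n$ with respect to $t$: $$f(x_0+th)=o(t^n).$$
   Context: A complete division ring of characteristic $0$ is a division ring $D$ of characteristic $0$ with an absolute value $|\cdot|:D\to\mathbb R$ ($|a|\ge0$, $|a|=0$ iff $a=0$, $|ab|=|a||b|$, $|a+b|\le|a|+|b|$), complete for the metric $|a-b|$, such that the embedding of the rational field $\mathbb Q$ (usual topology) into $D$ is a homeomorphism onto its image; then $\mathbb R$ is a subfield of the center $Z(D)$. A map $f:D\to D$ is differentiable in the Gâteaux sense if at every $x$ one has $f(x+a)-f(x)=\partial f(x)(a)+o(a)$, where $a\mapsto\partial f(x)(a)$ is linear (additive and homogeneous over $Z(D)$) and $o$ is a continuous map with $|o(a)|/|a|\to0$ as $a\to0$; then $\partial f(x)(a)=\lim_{t\to0,\,t\in\mathbb R}t^{-1}(f(x+ta)-f(x))$. Higher derivatives: $\partial^0f(x)=f(x)$ and $\partial^nf(x)(h_1;\dots;h_n)=\partial\big(\partial^{n-1}f(x)(h_1;\dots;h_{n-1})\big)(h_n)$, the outer $\partial$ being taken with respect to $x$. Notation: $\partial^nf(x)(h)=\partial^nf(x)(h;\dots;h)$. The relation $g(t)=o(t^n)$ for $g:\mathbb R\to D$ means $|g(t)|/|t^n|\to0$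 as $t\to0$. *)

(* Defs.v *)
From HB Require Import structures.
From mathcomp Require Import all_boot all_order all_algebra.
From mathcomp Require Import all_classical all_reals all_analysis.

Set Implicit Arguments.
Unset Strict Implicit.
Unset Printing Implicit Defensive.

Import Order.TTheory GRing.Theory Num.Theory.
Import numFieldNormedType.Exports.

Local Open Scope classical_set_scope.
Local Open Scope ring_scope.

(* The absolute value is not a norm in the sense of [normedZmodType]: that
   structure forces |n| = n for every natural number n, whereas here |n| = n^s
   with 0 < s < 1 is possible. *)
Record absvDivRing (R : realType) := AbsvDivRing {
  absv_sort :> unitRingType;
  absv : absv_sort -> R;
  absv_fieldP : GRing.field_axiom absv_sort;
  absv_pchar0 : [pchar absv_sort] =i pred0;
  absv_ge0 : forall a, 0 <= absv a;
  absv_eq0P : forall a, absv a = 0 <-> a = 0;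
  absvM : {morph absv : a b / a * b};
  absvD : forall a b, absv (a + b) <= absv a + absv b
}.

Arguments absv {R D} a : rename.

(* A copy of D carrying the topology of the metric |a - b|. *)
Definition metric_of (R : realType) (D : absvDivRing R) : Type := D.

Notation "D ^m" := (metric_of D) (at level 2, format "D ^m") : type_scope.

Section Metric.
Variables (R : realType) (D : absvDivRing R).
Implicit Types a b c : D.

Let dist a b : R := absv (a - b).

Lemma absv1 : absv (1 : D) = 1.
Proof.
have /mulfI : absv (1 : D) != 0.
  by apply/eqP => /absv_eq0P/eqP; rewrite oner_eq0.
by apply; rewrite -absvM !mulr1.
Qed.

Lemma absvN a : absv (- a) = absv a.
Proof.
rewrite -mulN1r absvM -[RHS]mul1r; congr (_ * _).
apply/eqP; rewrite -[_ == _](@eqrXn2 _ 2) ?absv_ge0//.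
by rewrite expr1n expr2 -absvM mulrNN mulr1 absv1.
Qed.

Let distxx a : dist a a = 0.
Proof. by rewrite /dist subrr; apply/absv_eq0P. Qed.

Let dist_positivity a b : dist a b = 0 -> a = b.
Proof. by move=> /absv_eq0P/subr0_eq. Qed.

Let dist_sym a b : dist a b = dist b a.
Proof. by rewrite /dist -absvN opprB. Qed.

Let dist_triangle b a c : dist a c <= dist a b + dist b c.
Proof. by rewrite /dist (le_trans _ (absvD _ _))// addrA subrK. Qed.

HB.instance Definition _ := Choice.on D^m.
HB.instance Definition _ := @isMetric.Build R D^m
  dist distxx dist_positivity dist_sym dist_triangle.

End Metric.

Definition homeo_onto_image (S T : topologicalType) (j : S -> T) : Prop :=
  [/\ injective j, continuous j &
      forall A : set S, open A ->
        exists2 B : set T, open B & j @` A = B `&` range j].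

Record completeDivRing (R : realType) := CompleteDivRing {
  divring_sort :> absvDivRing R;
  divring_complete : forall u : nat -> divring_sort^m,
    cauchy (u n @[n --> \oo]) ->
    exists l : divring_sort^m, u n @[n --> \oo] --> l;
  divring_ratr : homeo_onto_image (ratr : rat^o -> divring_sort^m)
}.

Section RealEmbedding.
Variables (R : realType) (D : completeDivRing R).

(* The copy of the real number t in D: the limit in D of any sequence of
   rational numbers converging to t in R, see [cvg_real_emb]. *)
Definition real_emb (t : R) : D :=
  xget 0 [set a : D | exists2 u : nat -> rat,
    (ratr (u n) : R) @[n --> \oo] --> t &
    (ratr (u n) : D^m) @[n --> \oo] --> (a : D^m)].

Let natr_neq0 (n : nat) : (0 < n)%N -> (n%:R : D) != 0.
Proof.
elim/ltn_ind: n => n IH n0; have [n1|n1] := leqP n 1.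
  by rewrite (_ : n = 1%N) ?oner_neq0//; apply/eqP; rewrite eqn_leq n1.
have pp := pdiv_prime n1.
apply/eqP => nD0; have : absv (n%:R : D) = 0 by rewrite nD0; apply/absv_eq0P.
rewrite -(divnK (pdiv_dvd n)) natrM absvM => /eqP.
rewrite mulf_eq0 => /orP[] /eqP/absv_eq0P/eqP; apply/negP.
  apply: IH; last by rewrite divn_gt0 ?prime_gt0// pdiv_leq.
  by rewrite ltn_Pdiv// prime_gt1.
by have := absv_pchar0 D (pdiv n); rewrite !inE pp/= => ->.
Qed.

Let intr_unit (z : int) : z != 0 -> (z%:~R : D) \is a GRing.unit.
Proof.
move=> z0; apply: absv_fieldP; rewrite (intEsign z) rmorphM/= rmorph_sign.
by rewrite mulr_sign; case: ifP => _; rewrite ?oppr_eq0 natr_neq0// absz_gt0.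
Qed.

Let intr_comm (x : D) (z : int) : GRing.comm x z%:~R.
Proof. exact: commr_int. Qed.

Let ratr_frac (a b : int) : b != 0 ->
  ratr (a%:~R / b%:~R : rat) = a%:~R / b%:~R :> D.
Proof.
move=> b0; set q : rat := _ / _; rewrite /ratr.
have bq0 : (b%:~R : rat) != 0 by rewrite intr_eq0.
have dq0 : ((denq q)%:~R : rat) != 0 by rewrite intr_eq0 denq_neq0.
have E : numq q * b = a * denq q.
  apply: (@intr_inj rat); rewrite !rmorphM/=.
  by rewrite numqE mulrAC /q divfK.
have uq := intr_unit (denq_neq0 q); have ub := intr_unit b0.
apply: (canLR (mulrK uq)).
rewrite -mulrA intr_comm mulrA.
by apply: (canRL (mulrK ub)); rewrite -!rmorphM/= E.
Qed.

Let ratrBD (p q : rat) : ratr (p - q) = ratr p - ratr q :> D.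
Proof.
have p0 := denq_neq0 p; have q0 := denq_neq0 q.
have -> : p - q = (numq p * denq q - numq q * denq p)%:~R
                  / (denq p * denq q)%:~R.
  rewrite -[in LHS](divq_num_den p) -[in LHS](divq_num_den q).
  by rewrite -[X in _ + X = _]mulNr addf_div ?intr_eq0// mulNr rmorphB !rmorphM.
rewrite ratr_frac ?mulf_neq0//.
have up := intr_unit p0; have uq := intr_unit q0.
rewrite /ratr; apply: (canLR (mulrK _)); first by rewrite rmorphM/= unitrMr.
rewrite rmorphB !rmorphM/= mulrBl; congr (_ - _).
  by rewrite mulrA mulrVK.
by rewrite [X in _ / _ * X]intr_comm mulrA mulrVK.
Qed.

Let ratr_small (e : R) : 0 < e ->
  exists2 d : rat, 0 < d & forall q : rat, `|q| < d -> absv (ratr q : D) < e.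
Proof.
move=> e0; have [_ ratr_cont _] := divring_ratr D.
have /(_ _ (nbhsx_ballx _ e e0)) := ratr_cont 0.
case=> d /= d0 /subsetP dP; exists d => // q qd.
have /dP : - q \in ball_ (fun x : rat => `|x|) 0 d by rewrite inE/= sub0r opprK.
rewrite inE/= ballEmdist/= [mdist _ _](_ : _ = absv (ratr 0 - ratr (- q) : D))//.
by rewrite -ratrBD sub0r opprK.
Qed.

Let cvg_metric (u : nat -> D) (a : D) :
  (forall e, 0 < e -> \forall n \near \oo, absv (a - u n) < e) ->
  (u n : D^m) @[n --> \oo] --> (a : D^m).
Proof.
move=> H; apply/cvg_ballP => e e0; near=> n; rewrite ballEmdist/=.
by near: n; exact: H.
Unshelve. all: by end_near. Qed.

Let metric_cvg (u : nat -> D) (a : D) :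
  (u n : D^m) @[n --> \oo] --> (a : D^m) ->
  forall e, 0 < e -> \forall n \near \oo, absv (a - u n) < e.
Proof.
move=> /cvg_ballP H e e0; near=> n.
have : ball (a : D^m) e (u n) by near: n; exact: H.
by rewrite ballEmdist.
Unshelve. all: by end_near. Qed.

Lemma cvg_real_emb (t : R) (u : nat -> rat) :
  (ratr (u n) : R) @[n --> \oo] --> t ->
  (ratr (u n) : D^m) @[n --> \oo] --> (real_emb t : D^m).
Proof.
have close (v w : nat -> rat) e : 0 < e ->
    (ratr (v n) : R) @[n --> \oo] --> t ->
    (ratr (w n) : R) @[n --> \oo] --> t ->
    exists N, forall m n, (N <= m)%N -> (N <= n)%N ->
      absv (ratr (v m) - ratr (w n) : D) < e.
  move=> e0 vt wt; have [d d0 dP] := ratr_small e0.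
  have d20 : 0 < (ratr d : R) / 2 by rewrite divr_gt0 ?ltr0q.
  have [N1 _ H1] := (cvgrPdist_lt _ _).1 vt _ d20.
  have [N2 _ H2] := (cvgrPdist_lt _ _).1 wt _ d20.
  exists (maxn N1 N2) => m n; rewrite !geq_max => /andP[m1 _] /andP[_ n2].
  rewrite -ratrBD; apply: dP; rewrite -(ltr_rat R) ratr_norm rmorphB/=.
  rewrite -(subrK t (ratr _)) -addrA (le_lt_trans (ler_normD _ _))//.
  by rewrite [ltRHS]splitr ltrD//; [rewrite distrC; exact: H1|exact: H2].
move=> ut.
suff : [set a : D | exists2 u : nat -> rat,
    (ratr (u n) : R) @[n --> \oo] --> t &
    (ratr (u n) : D^m) @[n --> \oo] --> (a : D^m)] (real_emb t).
  case=> v vt vD; apply: cvg_metric => e e0.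
  have e20 : 0 < e / 2 by rewrite divr_gt0.
  have [N NP] := close _ _ _ e20 vt ut.
  have [M _ MP] := metric_cvg vD e20.
  exists N => // n /= Nn.
  have -> : real_emb t - ratr (u n) =
      (real_emb t - ratr (v (maxn M N))) +
      (ratr (v (maxn M N)) - ratr (u n)) by rewrite addrA subrK.
  rewrite (le_lt_trans (absvD _ _))// [ltRHS]splitr ltrD//.
    by apply: MP; rewrite /= leq_maxl.
  by apply: NP => //; rewrite leq_maxr.
rewrite /real_emb; apply: xgetPex.
have [|l lP] := @divring_complete _ D (fun n => ratr (u n)); last first.
  by exists l, u.
apply/cauchy_ballP => e e0; have [N NP] := close _ _ _ e0 ut ut.
exists (((fun n => ratr (u n)) @` [set n | (N <= n)%N] : set D^m),
        ((fun n => ratr (u n)) @` [set n | (N <= n)%N] : set D^m)).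
  by split; exists N => // n /= Nn; exists n.
move=> [_ _] [/= [m Nm <-] [n Nn <-]]; rewrite ballEmdist/=.
exact: NP.
Qed.

End RealEmbedding.

Section GateauxDifferential.
Variables (R : realType) (D : completeDivRing R).
Implicit Types (f L : D -> D) (x a z : D).

Definition center_linear L : Prop :=
  {morph L : a b / a + b} /\
  forall z, (forall y, GRing.comm z y) -> forall a, L (z * a) = z * L a.

Definition gateaux_differential f x L : Prop :=
  center_linear L /\
  exists o : D^m -> D^m, [/\ continuous o,
    (absv (o a : D) / absv (a : D)) @[a --> ((0 : D) : D^m)^'] --> (0 : R) &
    forall a : D, f (x + a) - f x = L a + o a].

Definition gateaux_differentiable f : Prop :=
  forall x, exists L, gateaux_differential f x L.

Definition gderive f x : D -> D :=
  xget (fun=> 0) [set L | gateaux_differential f x L].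

(* [gderiven f [:: h1; ...; hn] x] is the n-th derivative of f at x applied to
   (h1; ...; hn): h1 is the innermost direction, hn the outermost. *)
Definition gderiven f (hs : seq D) : D -> D :=
  foldl (fun g h x => gderive g x h) f hs.

Definition gateaux_smooth f : Prop :=
  forall hs : seq D, gateaux_differentiable (gderiven f hs).

(* |t^n| is computed in D, where the real number t is embedded. *)
Definition littleo_pow (n : nat) (g : R -> D) : Prop :=
  (absv (g t) / absv (real_emb D t ^+ n)) @[t --> (0 : R)^'] --> (0 : R).

End GateauxDifferential.

(* Main.v *)
Require Import Defs.
From HB Require Import structures.
From mathcomp Require Import all_boot all_order all_algebra.
From mathcomp Require Import all_classical all_reals all_analysis.
From mathcomp Require Import ring lra.

(** The real numbers form a central subfield of D, so f restricted to the line
    t |-> x0 + t h is a curve in D whose k-th derivative is the k-th Gateaux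
    derivative of f in the direction h ([curve_derivative_line]). The theorem is
    then Taylor's: an estimate on F' near 0 is turned into one for F, with one
    more factor t, by the mean value inequality ([curve_mean_value]), and n such
    steps lead from the continuity at 0 of the n-th derivative of the curve to
    the claim ([curve_taylor]).

    The obstacle is that |t| in D, for t real, need not be the usual absolute
    value: it is |t|^s for some 0 < s <= 1. When s < 1, a triangle inequality
    for an s-homogeneous function is too weak for the mean value inequality:
    in the space L^s of the unit interval, the curve of the indicator functions
    of [0, t] has derivative 0 and is not constant. What saves the theorem is
    that the absolute value of D is multiplicative. Write w t for the absolute
    value of the real number t in D, and say that a has size at most A >= 0 when
    |a| <= w A. Sizes add: if a and b have sizes at most A and B, then a + b has
    size at most A + B ([absvD_rabsv]). Indeed, by the binomial formula,
    |a + b|^n is at most a sum of n + 1 terms, each of which is at most the value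
    of w at one of the terms of (A + B)^n, so that
    |a + b|^n <= (n + 1) (w (A + B))^n for all n. Since a and b need not commute,
    the formula is applied to a b^-1 and 1. With sizes in the place of norms, the
    classical proof of the mean value inequality goes through. *)

Set Implicit Arguments.
Unset Strict Implicit.
Unset Printing Implicit Defensive.

Import Order.TTheory GRing.Theory Num.Theory.
Import numFieldNormedType.Exports.

Local Open Scope classical_set_scope.
Local Open Scope ring_scope.

(** * The absolute value *)

Section AbsoluteValue.
Variables (R : realType) (D : absvDivRing R).
Implicit Types a b c : D.

Lemma absv0 : absv (0 : D) = 0.
Proof. exact/absv_eq0P. Qed.

Lemma absv_eq0 a : (absv a == 0) = (a == 0).
Proof. by apply/eqP/eqP => /absv_eq0P. Qed.

Lemma absv_gt0 a : (0 < absv a) = (a != 0).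
Proof. by rewrite lt0r absv_ge0 andbT absv_eq0. Qed.

Lemma absvX a n : absv (a ^+ n) = absv a ^+ n.
Proof. by elim: n => [|n IH]; rewrite ?absv1// !exprS absvM IH. Qed.

Lemma absv_sum (I : Type) (s : seq I) (F : I -> D) :
  absv (\sum_(i <- s) F i) <= \sum_(i <- s) absv (F i).
Proof.
elim/big_ind2 : _ => [|x y a b xy ab|//]; first by rewrite absv0.
by rewrite (le_trans (absvD _ _))// lerD.
Qed.

Lemma absvBC a b : absv (a - b) = absv (b - a).
Proof. by rewrite -absvN opprB. Qed.

Lemma metric_cvgP (u : nat -> D) a :
  (u n : D^m) @[n --> \oo] --> (a : D^m) ->
  absv (a - u n) @[n --> \oo] --> (0 : R).
Proof.
move=> /cvg_ballP ua; apply/cvgr0Pnorm_lt => e e0; near=> n.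
have : ball (a : D^m) e (u n) by near: n; exact: ua.
by rewrite ballEmdist/= ger0_norm ?absv_ge0.
Unshelve. all: by end_near. Qed.

End AbsoluteValue.

(** * The real numbers inside the division ring *)

Section RealEmbTheory.
Variables (R : realType) (D : completeDivRing R).
Implicit Types (a b c : D) (s t : R) (p q : rat).

Lemma ratr_inj : injective (ratr : rat -> D).
Proof. by have [] := divring_ratr D. Qed.

Lemma intr_unit (z : int) : z != 0 -> (z%:~R : D) \is a GRing.unit.
Proof.
move=> z0; apply: absv_fieldP; apply: contra z0 => /eqP zD0.
have /ratr_inj/eqP : ratr z%:~R = ratr 0%:~R :> D by rewrite !ratr_int zD0.
by rewrite eqr_int.
Qed.

(** A fraction is determined by the integral equation that it solves, which
    replaces computing with reduced numerators and denominators. *)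
Lemma ratr_unique q (m d : int) a : d != 0 ->
  q * d%:~R = m%:~R -> a * d%:~R = m%:~R -> a = ratr q.
Proof.
move=> d0 qd ad; have ud := intr_unit d0; have uq := intr_unit (denq_neq0 q).
have E : m * denq q = numq q * d.
  by apply: (@intr_inj rat); rewrite !rmorphM/= -qd numqE mulrAC.
rewrite -[a](mulrK ud) ad /ratr; apply: (canLR (mulrK ud)).
rewrite -mulrA [_ * d%:~R]commr_int mulrA.
by apply: (canRL (mulrK uq)); rewrite -!rmorphM/= E.
Qed.

Lemma ratrK q : (ratr q : D) * (denq q)%:~R = (numq q)%:~R.
Proof. by rewrite /ratr mulrVK// intr_unit// denq_neq0. Qed.

Lemma ratrD p q : ratr (p + q) = ratr p + ratr q :> D.
Proof.
apply/esym/(@ratr_unique _ (numq p * denq q + numq q * denq p)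
  (denq p * denq q)); first by rewrite mulf_neq0 ?denq_neq0.
  rewrite rmorphD !rmorphM/= !numqE mulrDl mulrA; congr (_ + _).
  by rewrite (mulrC (denq p)%:~R) mulrA.
rewrite rmorphD !rmorphM/= -!ratrK mulrDl mulrA; congr (_ + _).
by rewrite -rmorphM/= mulrC rmorphM/= mulrA.
Qed.

Lemma ratrM p q : ratr (p * q) = ratr p * ratr q :> D.
Proof.
apply/esym/(@ratr_unique _ (numq p * numq q) (denq p * denq q)).
- by rewrite mulf_neq0 ?denq_neq0.
- by rewrite !rmorphM/= !numqE mulrACA.
rewrite !rmorphM/= -!ratrK -[LHS]mulrA -[RHS]mulrA; congr (_ * _).
by rewrite [LHS]mulrA [_ * (denq p)%:~R]commr_int -mulrA.
Qed.

Lemma ratrN q : ratr (- q) = - ratr q :> D.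
Proof.
apply/eqP; rewrite -subr_eq0 opprK -ratrD addNr.
by rewrite -[0]/(0%:~R) ratr_int.
Qed.

Lemma ratr_comm q a : GRing.comm a (ratr q).
Proof.
have ud := intr_unit (denq_neq0 q).
apply: (mulIr ud); rewrite -mulrA ratrK commr_int -mulrA.
by rewrite [a * _]commr_int mulrA ratrK.
Qed.

Lemma ratr_small (e : R) : 0 < e ->
  exists2 d : R, 0 < d & forall q, `|ratr q| < d -> absv (ratr q : D) < e.
Proof.
move=> e0; have [_ ratr_cont _] := divring_ratr D.
have /(_ _ (nbhsx_ballx _ e e0)) := ratr_cont 0.
case=> d /= d0 /subsetP dP; exists (ratr d); first by rewrite ltr0q.
move=> q; rewrite -ratr_norm ltr_rat => qd.
have /dP : - q \in ball_ (fun x : rat => `|x|) 0 d by rewrite inE/= sub0r opprK.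
rewrite inE/= ballEmdist/= [mdist _ _](_ : _ = absv (ratr 0 - ratr (- q) : D))//.
by rewrite ratrN opprK -ratrD add0r.
Qed.

Lemma rat_cvg_to t : exists u : nat -> rat,
  (ratr (u n) : R) @[n --> \oo] --> t.
Proof.
have H n : exists q : rat, `|t - ratr q| < (n.+1%:R)^-1.
  have [|q] := @rat_in_itvoo R (t - n.+1%:R^-1) (t + n.+1%:R^-1).
    by rewrite ltrBlDr -addrA ltrDl addr_gt0// invr_gt0.
  by rewrite in_itv/= => qt; exists q; rewrite distrC ltr_distl.
have [u uP] := choice H; exists u; apply/cvgrPdist_lt => e e0.
have [N _ NP] := (cvgr0Pnorm_lt _).1 (@cvg_harmonic R) e e0.
exists N => // n /= /NP; rewrite ger0_norm ?harmonic_ge0// => ne.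
exact: lt_trans (uP n) ne.
Qed.

(** Every real number and its image in D are approximated at once by the same
    rational numbers; identities and estimates over the rationals pass to the
    limit through the real sequences |a - u n|. *)
Lemma real_embP t : exists u : nat -> rat,
  (ratr (u n) : R) @[n --> \oo] --> t /\
  absv (real_emb D t - ratr (u n)) @[n --> \oo] --> (0 : R).
Proof.
have [u ut] := rat_cvg_to t; exists u; split => //.
exact/metric_cvgP/cvg_real_emb.
Qed.

Lemma real_emb_cvg t (u : nat -> rat) : (ratr (u n) : R) @[n --> \oo] --> t ->
  absv (real_emb D t - ratr (u n)) @[n --> \oo] --> (0 : R).
Proof. by move=> ut; exact/metric_cvgP/cvg_real_emb. Qed.

Lemma absv_eq_lim a b (v : nat -> R) : (forall n, absv (a - b) <= v n) ->
  v n @[n --> \oo] --> (0 : R) -> a = b.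
Proof.
move=> abv v0; apply/eqP; rewrite -subr_eq0 -absv_eq0 eq_le absv_ge0 andbT.
by apply: (ler_cvg_to (@cvg_cst _ _ _ _ _) v0); apply: nearW.
Qed.

Lemma real_emb_rat q : real_emb D (ratr q) = ratr q.
Proof.
apply: (@absv_eq_lim _ _ (fun=> absv (real_emb D (ratr q) - ratr q))) => //.
by apply: (@real_emb_cvg _ (fun=> q)); exact: cvg_cst.
Qed.

Lemma real_embD s t : real_emb D (s + t) = real_emb D s + real_emb D t.
Proof.
have [u [us uD]] := real_embP s; have [v [vt vD]] := real_embP t.
have uvD : absv (real_emb D (s + t) - ratr (u n + v n)) @[n --> \oo] --> (0 : R).
  apply: real_emb_cvg; under eq_fun do rewrite rmorphD/=; exact: cvgD.
apply: (absv_eq_lim _ (v := fun n => absv (real_emb D (s + t) - ratr (u n + v n))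
  + (absv (real_emb D s - ratr (u n)) + absv (real_emb D t - ratr (v n))))).
  move=> n; rewrite -[X in absv (X - _) <= _](subrK (ratr (u n + v n))) -addrA.
  rewrite (le_trans (absvD _ _))// lerD2l ratrD opprD addrACA.
  by rewrite (absvBC (real_emb D s)) (absvBC (real_emb D t)) absvD.
rewrite -[X in _ --> X]addr0; apply: cvgD => //.
by rewrite -[X in _ --> X]addr0; exact: cvgD.
Qed.

Lemma real_embM s t : real_emb D (s * t) = real_emb D s * real_emb D t.
Proof.
have [u [us uD]] := real_embP s; have [v [vt vD]] := real_embP t.
have uvD : absv (real_emb D (s * t) - ratr (u n * v n)) @[n --> \oo] --> (0 : R).
  apply: real_emb_cvg; under eq_fun do rewrite rmorphM/=; exact: cvgM.
apply: (absv_eq_lim _ (v := fun n => absv (real_emb D (s * t) - ratr (u n * v n))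
  + (absv (real_emb D s) * absv (real_emb D t - ratr (v n)) +
     absv (real_emb D s - ratr (u n)) *
     (absv (real_emb D t - ratr (v n)) + absv (real_emb D t))))).
  move=> n; rewrite -[X in absv (X - _) <= _](subrK (ratr (u n * v n))) -addrA.
  rewrite (le_trans (absvD _ _))// lerD2l [leLHS]absvBC ratrM.
  have -> : real_emb D s * real_emb D t - ratr (u n) * ratr (v n) =
      real_emb D s * (real_emb D t - ratr (v n)) +
      (real_emb D s - ratr (u n)) * ratr (v n).
    by rewrite mulrBr mulrBl addrA subrK.
  rewrite (le_trans (absvD _ _))// (absvM (real_emb D s)) (absvM (_ - _)).
  rewrite lerD2l ler_wpM2l ?absv_ge0//.
  rewrite -[X in absv X <= _](subrK (real_emb D t)).
  by rewrite (le_trans (absvD _ _))// absvBC.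
have z1 : 0 + (absv (real_emb D s) * 0 + 0 * (0 + absv (real_emb D t))) = 0.
  by rewrite mulr0 mul0r !addr0.
rewrite -[X in _ --> X]z1; apply: cvgD => //; apply: cvgD.
  by apply: cvgM => //; exact: cvg_cst.
by apply: cvgM => //; apply: cvgD => //; exact: cvg_cst.
Qed.

Lemma real_emb_comm a t : GRing.comm (real_emb D t) a.
Proof.
have [u [_ uD]] := real_embP t.
apply: (absv_eq_lim _ (v := fun n => absv (real_emb D t - ratr (u n)) * absv a
  + absv a * absv (real_emb D t - ratr (u n)))).
  move=> n; have -> : real_emb D t * a - a * real_emb D t =
     (real_emb D t - ratr (u n)) * a + a * (ratr (u n) - real_emb D t).
    by rewrite mulrBl mulrBr [a * ratr _]ratr_comm addrA subrK.
  by rewrite (le_trans (absvD _ _))// !absvM (absvBC (ratr _)).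
have z1 : 0 * absv a + absv a * 0 = 0 by rewrite mulr0 mul0r addr0.
by rewrite -[X in _ --> X]z1; apply: cvgD; apply: cvgM => //; exact: cvg_cst.
Qed.

Lemma real_emb_nat n : real_emb D n%:R = n%:R.
Proof.
by rewrite -[n%:R in LHS](@ratr_int R n%:Z) real_emb_rat ratr_int.
Qed.

Lemma real_embN t : real_emb D (- t) = - real_emb D t.
Proof.
apply/eqP; rewrite -subr_eq0 opprK -real_embD addNr.
by have := real_emb_nat 0 => ->.
Qed.

End RealEmbTheory.

(** * The absolute value on the real numbers *)

Section RealAbsv.
Variables (R : realType) (D : completeDivRing R).
Implicit Types (a b c : D) (s t : R).

(** This is |t|^s for some 0 < s <= 1. The exponent is never extracted: the
    function is multiplicative, grows with the usual absolute value of t and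
    tends to 0 at 0. *)
Definition rabsv t : R := absv (real_emb D t).

Lemma rabsvE t : absv (real_emb D t) = rabsv t.
Proof. by []. Qed.

Lemma rabsv_ge0 t : 0 <= rabsv t.
Proof. exact: absv_ge0. Qed.

Lemma rabsvM s t : rabsv (s * t) = rabsv s * rabsv t.
Proof. by rewrite /rabsv real_embM absvM. Qed.

Lemma rabsv0 : rabsv 0 = 0.
Proof. by rewrite /rabsv (real_emb_nat D 0) absv0. Qed.

Lemma rabsv1 : rabsv 1 = 1.
Proof. by rewrite /rabsv (real_emb_nat D 1) absv1. Qed.

Lemma rabsvX t n : rabsv (t ^+ n) = rabsv t ^+ n.
Proof. by elim: n => [|n IH]; rewrite ?rabsv1// !exprS rabsvM IH. Qed.

Lemma rabsvN t : rabsv (- t) = rabsv t.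
Proof. by rewrite /rabsv real_embN absvN. Qed.

Lemma rabsv_norm t : rabsv `|t| = rabsv t.
Proof. by case: (ger0P t) => _; [|rewrite rabsvN]. Qed.

Lemma rabsv_gt0 t : (0 < rabsv t) = (t != 0).
Proof.
have [->|t0] := eqVneq t 0; first by rewrite rabsv0 ltxx.
rewrite lt0r rabsv_ge0 andbT; apply/eqP => w0.
have := rabsvM t t^-1; rewrite w0 mul0r divff// rabsv1 => /eqP.
by rewrite oner_eq0.
Qed.

Lemma rabsv_small (e : R) : 0 < e ->
  exists2 d : R, 0 < d & forall t, `|t| < d -> rabsv t < e.
Proof.
move=> e0; have e20 : 0 < e / 2 by rewrite divr_gt0.
have [d d0 dP] := ratr_small D e20; exists d => // t td.
have [u [ut uD]] := real_embP D t.
have [N _ NP] := (cvgr0Pnorm_lt _).1 uD _ e20.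
have [M _ MP] := (cvgr_norm_lt _ ut _ td).
have n1 : (N <= maxn N M)%N by rewrite leq_maxl.
have n2 : (M <= maxn N M)%N by rewrite leq_maxr.
rewrite /rabsv -(subrK (ratr (u (maxn N M))) (real_emb D t)).
rewrite (le_lt_trans (absvD _ _))// [ltRHS]splitr ltrD//.
  by rewrite (le_lt_trans (ler_norm _))//; exact: NP.
by apply: dP; exact: MP.
Qed.

(** The powers of t tend to 0, hence so do those of its absolute value. *)
Lemma rabsv_lt1 t : `|t| < 1 -> rabsv t < 1.
Proof.
move=> t1; have [d d0 dP] := rabsv_small ltr01.
have [N _ /(_ N (leqnn N))/=] := (cvgr0Pnorm_lt _).1 (cvg_expr t1) d d0.
move=> /dP; rewrite rabsvX; apply: contraTT; rewrite -!leNgt.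
exact: exprn_ege1.
Qed.

Lemma rabsv_le s t : `|s| <= `|t| -> rabsv s <= rabsv t.
Proof.
rewrite -[rabsv s]rabsv_norm -[rabsv t]rabsv_norm le_eqVlt.
move=> /predU1P[->//|st].
have t0 : 0 < `|t| by exact: le_lt_trans st.
rewrite -[`|s|](divfK (lt0r_neq0 t0)) rabsvM ler_piMl ?rabsv_ge0//.
by rewrite ltW// rabsv_lt1// normf_div !normr_id ltr_pdivrMr// mul1r.
Qed.

(** Powers of r > 1 grow faster than any multiple of the exponent: the square of
    Bernoulli's inequality is already quadratic in it. *)
Lemma le1_of_expr_linear (r : R) : 0 <= r ->
  (forall n, r ^+ n <= n.+1%:R) -> r <= 1.
Proof.
move=> r0 rn; rewrite leNgt; apply/negP => r1.
have x0 : 0 < r - 1 by rewrite subr_gt0.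
have bern n : 1 + n%:R * (r - 1) <= r ^+ n.
  elim: n => [|n IH]; first by rewrite mul0r addr0 expr0.
  rewrite exprS -natr1; set k := n%:R in IH *.
  have k0 : 0 <= k by rewrite ler0n.
  have : r * (1 + k * (r - 1)) <= r * r ^+ n by rewrite ler_wpM2l.
  apply: le_trans; have : 0 <= k * (r - 1) ^+ 2 by rewrite mulr_ge0 ?sqr_ge0.
  by rewrite expr2; nra.
pose n := Num.bound (2 / (r - 1) ^+ 2).
have n2 : 2 < n%:R * (r - 1) ^+ 2.
  by rewrite -ltr_pdivrMr ?exprn_gt0// archi_boundP// divr_ge0// exprn_ge0// ltW.
have := rn (n * 2)%N; apply/negP; rewrite -ltNge exprM.
have b := bern n; have k0 : 0 <= n%:R :> R by rewrite ler0n.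
have : (1 + n%:R * (r - 1)) ^+ 2 <= (r ^+ n) ^+ 2.
  by rewrite lerXn2r// nnegrE ?exprn_ge0// addr_ge0// mulr_ge0// ltW.
apply: lt_le_trans; rewrite -natr1 natrM.
set k := n%:R in n2 k0 *.
have k1 : 0 < k by rewrite lt_neqAle k0 andbT; apply: contraTneq n2 => <-; lra.
have : k * 2 < k * (k * (r - 1) ^+ 2) by rewrite ltr_pM2l.
have : 0 <= k * (r - 1) by rewrite mulr_ge0// ltW.
by rewrite !expr2; lra.
Qed.

(** Writing a + b as (a b^-1 + 1) b makes the binomial formula available. Each of
    its terms, multiplied by b^n, is bounded by the absolute value in D of a term
    of (A + B)^n, hence by that of (A + B)^n itself, [rabsv] being increasing. *)
Lemma absv_binomial a b (A B : R) n : b != 0 -> 0 <= A -> 0 <= B ->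
  absv a <= rabsv A -> absv b <= rabsv B ->
  absv (a + b) ^+ n <= n.+1%:R * rabsv (A + B) ^+ n.
Proof.
move=> b0 A0 B0 aA bB; have ub : b \is a GRing.unit by exact: absv_fieldP.
pose c := a * b^-1; have cb : a = c * b by rewrite /c mulrVK.
have -> : a + b = (c + 1) * b by rewrite mulrDl mul1r -cb.
rewrite absvM exprMn -absvX exprD1n.
apply: (@le_trans _ _ (\sum_(i < n.+1)
    absv (c ^+ i *+ 'C(n, i)) * absv b ^+ n)).
  by rewrite -mulr_suml ler_wpM2r ?exprn_ge0 ?absv_ge0// absv_sum.
rewrite -[n.+1 in leRHS]card_ord mulr_natl -sumr_const; apply: ler_sum => i _.
have lein : (i <= n)%N by rewrite -ltnS.
have -> : absv (c ^+ i *+ 'C(n, i)) * absv b ^+ n =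
    rabsv 'C(n, i)%:R * (absv b ^+ (n - i) * absv a ^+ i).
  rewrite -mulr_natr absvM absvX /rabsv real_emb_nat cb absvM exprMn.
  have -> : absv b ^+ n = absv b ^+ (n - i) * absv b ^+ i.
    by rewrite -exprD subnK.
  by ring.
apply: (@le_trans _ _ (rabsv (B ^+ (n - i) * A ^+ i *+ 'C(n, i)))).
  rewrite -[in leRHS]mulr_natl !rabsvM !rabsvX ler_wpM2l ?rabsv_ge0//.
  apply: ler_pM; rewrite ?exprn_ge0 ?absv_ge0//.
    by apply: lerXn2r; rewrite ?nnegrE ?absv_ge0 ?rabsv_ge0 ?aA ?bB.
  by apply: lerXn2r; rewrite ?nnegrE ?absv_ge0 ?rabsv_ge0 ?aA ?bB.
have term_ge0 (j : 'I_n.+1) : 0 <= B ^+ (n - j) * A ^+ j *+ 'C(n, j).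
  by rewrite mulrn_wge0// mulr_ge0// exprn_ge0.
rewrite -rabsvX; apply: rabsv_le; rewrite !ger0_norm// ?exprn_ge0 ?addr_ge0//.
rewrite addrC exprDn (bigD1 i)//= lerDl; exact: sumr_ge0.
Qed.

(** This is the triangle inequality for a |-> |a|^(1/s). It is stronger than the
    triangle inequality for the absolute value when s < 1; it comes from taking
    n-th roots in the binomial estimate, as Artin does for valuations. *)
Lemma absvD_rabsv a b (A B : R) : 0 <= A -> 0 <= B ->
  absv a <= rabsv A -> absv b <= rabsv B -> absv (a + b) <= rabsv (A + B).
Proof.
move=> A0 B0 aA bB; have AB0 : 0 <= A + B by rewrite addr_ge0.
have [->|b0] := eqVneq b 0.
  rewrite addr0; apply: (le_trans aA); apply: rabsv_le.
  by rewrite !ger0_norm// lerDl.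
have w0 : 0 < rabsv (A + B).
  apply: (@lt_le_trans _ _ (rabsv B)).
    by rewrite (lt_le_trans _ bB)// absv_gt0.
  by rewrite rabsv_le// !ger0_norm// lerDr.
rewrite -[leRHS]mul1r -ler_pdivrMr//; apply: le1_of_expr_linear.
  by rewrite divr_ge0 ?absv_ge0// ltW.
move=> n; rewrite expr_div_n ler_pdivrMr ?exprn_gt0//.
exact: absv_binomial.
Qed.

End RealAbsv.

(** * Curves in the division ring *)

Section Curves.
Variables (R : realType) (D : completeDivRing R).
Implicit Types (F G : R -> D) (t u : R).
Local Notation rabsv := (rabsv D).

(** G is the derivative of F. Stating the limit of the difference quotients
    without division admits the increment u = 0. *)
Definition curve_derivative F G : Prop :=
  forall t (e : R), 0 < e -> exists2 d : R, 0 < d &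
    forall u, `|u| < d ->
      absv (F (t + u) - F t - real_emb D u * G t) <= e * rabsv u.

Lemma curve_derivative_scale F G t : curve_derivative F G ->
  curve_derivative (fun u => F (t * u)) (fun u => real_emb D t * G (t * u)).
Proof.
move=> FG u e e0.
have w1 : 0 < rabsv t + 1 by rewrite (lt_le_trans ltr01)// lerDr rabsv_ge0.
have [d d0 dP] := FG (t * u) (e / (rabsv t + 1)) (divr_gt0 e0 w1).
have t1 : 0 < `|t| + 1 by rewrite (lt_le_trans ltr01)// lerDr.
exists (d / (`|t| + 1)); first exact: divr_gt0.
move=> v; rewrite ltr_pdivlMr// => vd.
have tvd : `|t * v| < d.
  by rewrite (le_lt_trans _ vd)// normrM mulrC ler_wpM2l// lerDl.
rewrite mulrDr mulrA (_ : real_emb D v * _ = real_emb D (t * v)); last first.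
  by rewrite -real_embM mulrC.
rewrite (le_trans (dP _ tvd))// rabsvM mulrA ler_wpM2r ?rabsv_ge0//.
by rewrite -mulrA ler_piMr ?ltW// mulrC ltr_pdivrMr// mul1r ltrDl.
Qed.

(** A bound on the derivative at one point controls the increments from that
    point, with a constant that is as close to the bound as desired. *)
Lemma curve_increment F G t (C C' : R) : curve_derivative F G ->
  0 <= C -> C < C' -> absv (G t) <= rabsv C ->
  exists2 d : R, 0 < d & forall u, `|u| < d ->
    absv (F (t + u) - F t) <= rabsv (C' * `|u|).
Proof.
move=> FG C0 CC' GC.
have e0 : 0 < rabsv (C' - C) by rewrite rabsv_gt0 subr_eq0 gt_eqF.
have [d d0 dP] := FG t _ e0; exists d; [exact: d0|move=> u ud].
rewrite -(subrK (real_emb D u * G t) (F (t + u) - F t)).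
have -> : C' * `|u| = (C' - C) * `|u| + C * `|u| by rewrite -mulrDl subrK.
apply: absvD_rabsv.
- by rewrite mulr_ge0// subr_ge0 ltW.
- by rewrite mulr_ge0.
- by apply: (le_trans (dP _ ud)); rewrite rabsvM rabsv_norm.
rewrite absvM rabsvM rabsv_norm mulrC rabsvE.
by apply: ler_wpM2r GC; exact: rabsv_ge0.
Qed.

(** The supremum of the points t of [0, 1] at which the wanted estimate holds
    between 0 and t satisfies it, by the increments to the left of it, and is 1,
    by the increments to the right of it. *)
Lemma curve_mean_value F G (C C' : R) : curve_derivative F G ->
  0 <= C -> C < C' -> (forall t, 0 <= t <= 1 -> absv (G t) <= rabsv C) ->
  absv (F 1 - F 0) <= rabsv C'.
Proof.
move=> FG C0 CC' GC; have C'0 : 0 <= C' by rewrite (le_trans C0)// ltW.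
pose S := [set t | 0 <= t <= 1 /\ absv (F t - F 0) <= rabsv (C' * t)].
have S0 : S 0 by split; rewrite ?lexx ?ler01// subrr absv0 rabsv_ge0.
have Sub : ubound S 1 by move=> t [/andP[]].
have supS : has_sup S by split; [exists 0|exists 1].
pose m := sup S.
have m01 : 0 <= m <= 1.
  by rewrite /m ub_le_sup ?ge_sup//; [exists 0|exists 1].
(* sizes of successive increments add, so membership in S propagates *)
have chain s t : S s -> s <= t -> t <= 1 ->
    absv (F t - F s) <= rabsv (C' * (t - s)) -> S t.
  move=> [/andP[s0 s1] sS] st t1 FtFs; split; first by rewrite (le_trans s0).
  rewrite -[F t](subrK (F s)) -addrA -[t in leRHS](subrK s) mulrDr.
  by apply: absvD_rabsv => //; rewrite mulr_ge0// subr_ge0.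
have [d d0 dP] := curve_increment FG C0 CC' (GC _ m01).
have Sm : S m.
  have [t St mdt] := sup_adherent d0 supS.
  have tm : t <= m by exact: sup_upper_bound.
  have /andP[_ m1] := m01.
  apply: (chain t) => //.
  have td : `|t - m| < d.
    by rewrite distrC ger0_norm ?subr_ge0// ltrBlDl -ltrBlDr.
  have := dP _ td; rewrite (addrC m) subrK absvBC distrC ger0_norm ?subr_ge0//.
suff m1 : m = 1 by have [_] := Sm; rewrite m1 mulr1.
apply/eqP; rewrite eq_le; have /andP[_ ->] := m01; rewrite /= leNgt.
apply/negP => m1; pose u := Num.min (d / 2) (1 - m).
have u0 : 0 < u by rewrite lt_min divr_gt0// subr_gt0.
have ud : `|u| < d.
  rewrite gtr0_norm// gt_min; apply/orP; left.
  by rewrite ltr_pdivrMr// ltr_pMr// ltr1n.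
have : S (m + u).
  apply: (chain m) => //; first by rewrite lerDl ltW.
    by rewrite addrC -lerBrDr ge_min lexx orbT.
  by have := dP _ ud; rewrite addrAC subrr add0r gtr0_norm.
by move=> /(sup_upper_bound supS); rewrite leNgt ltrDl u0.
Qed.

(** By induction on n, applied to the sequence of derivatives that starts at
    F 1: the curve u |-> F (t u) has derivative t F' (t u), so the mean value
    inequality on [0, 1] turns an estimate in t^n for F' into one in t^(n+1)
    for F. *)
Lemma curve_taylor (F : nat -> R -> D) n (e : R) :
  (forall k, curve_derivative (F k) (F k.+1)) ->
  (forall k, (k <= n)%N -> F k 0 = 0) -> 0 < e ->
  exists2 d : R, 0 < d & forall t, `|t| < d ->
    absv (F 0%N t) <= rabsv (e * `|t| ^+ n).
Proof.
elim: n F e => [|n IH] F e FF F0 e0.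
  have [d d0 dP] := FF 0%N 0 _ ltr01.
  have g1 : 0 < 1 + absv (F 1%N 0).
    by rewrite (lt_le_trans ltr01)// lerDl absv_ge0.
  have we : 0 < rabsv e by rewrite rabsv_gt0 gt_eqF.
  have [d' d'0 d'P] := rabsv_small D (divr_gt0 we g1).
  exists (Num.min d d') => [|t]; first by rewrite lt_min d0.
  rewrite lt_min => /andP[td td']; rewrite expr0 mulr1.
  have := dP _ td; rewrite add0r F0// subr0 mul1r => Ft.
  rewrite -(subrK (real_emb D t * F 1%N 0) (F 0%N t)).
  apply: (le_trans (absvD _ _)); rewrite absvM rabsvE.
  have := d'P _ td'; rewrite ltr_pdivlMr// mulrDr mulr1 => /ltW.
  by apply: le_trans; rewrite lerD2r.
have e20 : 0 < e / 2 by rewrite divr_gt0.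
have [d d0 dP] := IH (fun k => F k.+1) _ (fun k => FF k.+1)
  (fun k => F0 k.+1) e20.
exists d => // t td; have [->|t0] := eqVneq t 0.
  by rewrite F0// absv0 rabsv_ge0.
have tn0 : 0 < `|t| ^+ n.+1 by rewrite exprn_gt0// normr_gt0.
have /(curve_mean_value (C := e / 2 * `|t| ^+ n.+1) (C' := e * `|t| ^+ n.+1)) :=
  curve_derivative_scale t (FF 0%N).
rewrite mulr1 mulr0 F0// subr0; apply.
- by rewrite mulr_ge0// ltW.
- by rewrite ltr_pM2r// ltr_pdivrMr// ltr_pMr// ltr1n.
move=> u /andP[u0 u1].
have tu : `|t * u| <= `|t| by rewrite normrM ler_piMr// ger0_norm.
rewrite absvM exprS mulrCA rabsvM rabsv_norm rabsvE ler_wpM2l ?absv_ge0//.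
rewrite (le_trans (dP _ (le_lt_trans tu td)))// rabsv_le//.
have norm_id (y : R) : `|e / 2 * `|y| ^+ n| = e / 2 * `|y| ^+ n.
  by rewrite ger0_norm// mulr_ge0 ?exprn_ge0 ?normr_ge0// ltW.
rewrite !norm_id ler_wpM2l ?(ltW e20)//.
by rewrite lerXn2r ?nnegrE ?normr_ge0.
Qed.

End Curves.

(** * Taylor expansion along a line *)

Section Line.
Variables (R : realType) (D : completeDivRing R).
Implicit Types (f : D -> D) (x h : D).

Lemma gderiveP f x : gateaux_differentiable f ->
  gateaux_differential f x (gderive f x).
Proof. by move=> fD; rewrite /gderive; apply: xgetPex; exact: fD. Qed.

(** The limit of |o a| / |a| is taken over nonzero a; the value of o at 0,
    forced by the expansion, makes the estimate valid for all small a, in particular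
    for the multiples of a zero direction h. *)
Lemma absv_gateaux_remainder (o : D^m -> D^m) :
  (absv (o a : D) / absv (a : D)) @[a --> ((0 : D) : D^m)^'] --> (0 : R) ->
  o (0 : D) = (0 : D) -> forall e : R, 0 < e -> exists2 d : R, 0 < d &
    forall a : D, absv a < d -> absv (o a : D) <= e * absv a.
Proof.
move=> /cvgr0Pnorm_lt olim o0 e e0.
have := olim e e0; rewrite near_withinE => /nbhs_ballP[d /= d0 dP].
exists d => // a ad; have [->|a0] := eqVneq a 0.
  by rewrite o0 absv0 mulr0.
have /dP/(_ a0) : ball ((0 : D) : D^m) d a.
  by rewrite ballEmdist/= [mdist _ _](_ : _ = absv (0 - a)) // sub0r absvN.
rewrite ger0_norm ?divr_ge0 ?absv_ge0// ltr_pdivrMr ?absv_gt0//.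
exact: ltW.
Qed.

(** The differential is homogeneous over the center, which contains the real
    numbers, so the Gateaux expansion restricts to the line through x. *)
Lemma curve_derivative_line f x h : gateaux_differentiable f ->
  curve_derivative (fun t => f (x + real_emb D t * h))
                   (fun t => gderive f (x + real_emb D t * h) h).
Proof.
move=> fD t e e0; set y := x + _.
have [[_ Lhom] [r [_ rlim rE]]] := gderiveP y fD.
have L0 : gderive f y 0 = 0.
  rewrite -[X in gderive f y X](mul0r 0) Lhom ?mul0r// => z.
  by rewrite /GRing.comm mul0r mulr0.
have r0 : r (0 : D) = (0 : D).
  by have := rE 0; rewrite addr0 subrr L0 add0r.
have h1 : 0 < absv h + 1 by rewrite (lt_le_trans ltr01)// lerDr absv_ge0.
have [d d0 dP] := absv_gateaux_remainder rlim r0 (divr_gt0 e0 h1).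
have [d' d'0 d'P] := rabsv_small D (divr_gt0 d0 h1).
exists d' => // u /d'P; rewrite ltr_pdivlMr// => ud.
rewrite real_embD mulrDl addrA -/y rE Lhom; last first.
  by move=> a; exact: real_emb_comm.
rewrite addrAC subrr add0r (le_trans (dP _ _))// absvM.
  by rewrite (le_lt_trans _ ud)// ler_wpM2l ?absv_ge0// lerDl.
rewrite rabsvE mulrCA [leRHS]mulrC ler_wpM2l ?rabsv_ge0//.
by rewrite -mulrA ler_piMr ?ltW// mulrC ltr_pdivrMr// mul1r ltrDl.
Qed.

Lemma gderivenS f n h x :
  gderiven f (nseq n.+1 h) x = gderive (gderiven f (nseq n h)) x h.
Proof. by rewrite /gderiven -addn1 nseqD foldl_cat. Qed.

Lemma littleo_powP n (g : R -> D) :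
  (forall e : R, 0 < e -> exists2 d : R, 0 < d & forall t, `|t| < d ->
    absv (g t) <= rabsv D (e * `|t| ^+ n)) -> littleo_pow n g.
Proof.
move=> gn; apply/cvgr0Pnorm_lt => e e0.
have [c c0 cP] := rabsv_small D e0.
have [d d0 dP] := gn (c / 2) (divr_gt0 c0 (@ltr0n R 2)).
rewrite near_withinE; exists d => //= t /=; rewrite sub0r normrN => td t0.
have w0 : 0 < absv (real_emb D t ^+ n).
  by rewrite absvX exprn_gt0// rabsvE rabsv_gt0.
rewrite ger0_norm ?divr_ge0 ?absv_ge0// ltr_pdivrMr//.
rewrite (le_lt_trans (dP _ td))// rabsvM rabsvX rabsv_norm absvX.
rewrite -absvX ltr_pM2r// cP// ger0_norm ?divr_ge0 ?ltW//.
by rewrite ltr_pdivrMr// ltr_pMr// ltr1n.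
Qed.

End Line.

Theorem theorem9p6 (R : realType) (D : completeDivRing R) (x0 h : D)
    (f : D -> D) (n : nat) (smooth_f : gateaux_smooth f)
    (f_vanish : forall k : nat, (k <= n)%N -> gderiven f (nseq k h) x0 = 0) :
  littleo_pow n (fun t : R => f (x0 + real_emb D t * h)).
Proof.
apply: littleo_powP => e e0.
pose F k (t : R) := gderiven f (nseq k h) (x0 + real_emb D t * h).
apply: (@curve_taylor _ _ F) => // k; last first.
  by rewrite /F (real_emb_nat D 0) mul0r addr0; exact: f_vanish.
rewrite /F; under [X in curve_derivative _ X]eq_fun do rewrite gderivenS.
exact: curve_derivative_line.
Qed.
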